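(* Let $X$ be a topological space and let $\mathcal{O}$ be the set of open covers of $X$. Then $\mathsf{S}_{\mathrm{bnd}}(\mathcal{O},\mathcal{O})$ holds if, and only if, Alice does not have a winning strategy in $\mathsf{G}_{\mathrm{bnd}}(\mathcal{O},\mathcal{O})$.
   Context: Here $\omega=\{0,1,2,\dots\}$. Let $\mathcal{A},\mathcal{B}$ be families of sets. $\mathsf{S}_{\mathrm{bnd}}(\mathcal{A},\mathcal{B})$ holds if for every sequence $\langle A_n:n\in\omega\rangle$ of elements of $\mathcal{A}$ there are a sequence $\langle B_n:n\in\omega\rangle$ and a $k\in\omega$ such that $B_n\subset A_n$ is finite with $|B_n|\le k$ for every $n\in\omega$, and $\bigcup_{n\in\omega}B_n\in\mathcal{B}$. The game $\mathsf{G}_{\mathrm{bnd}}(\mathcal{A},\mathcal{B})$ is played between Alice and Bob, with innings $n\in\omega$; in each inning $n$ Alice first chooses $A_n\in\mathcal{A}$ and then Bob responds with a finite $B_n\subset A_n$, each player knowing all previous moves. Bob wins if $\bigcup_{n\in\omega}B_n\in\mathcal{B}$ and there is a $k\in\omega$ such that $|B_n|\le k$ for every $n\in\omega$; otherwise Alice wins. *)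

(* Defs.v *)
From mathcomp Require Import all_boot.
From mathcomp Require Import boolp classical_sets functions cardinality.
From mathcomp Require Import topology_structure.

Set Implicit Arguments.
Unset Strict Implicit.
Unset Printing Implicit Defensive.

Local Open Scope classical_set_scope.
Local Open Scope card_scope.

(* A family of subsets of T is an element of set (set T); the points of T are
   the objects that get selected. For covers of a space X, T is set X. *)
Definition S_bnd (T : Type) (A B : set (set T)) : Prop :=
  forall As : nat -> set T, (forall n, A (As n)) ->
  exists (Bs : nat -> set T) (k : nat),
    (forall n, [/\ Bs n `<=` As n, finite_set (Bs n) & Bs n #<= `I_k]) /\
    B (\bigcup_n Bs n).

(* The moves made by both players before inning n, in order of play. *)
Definition history (T : Type) (As Bs : nat -> set T) (n : nat) :
    seq (set T * set T) :=
  mkseq (fun i => (As i, Bs i)) n.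

Definition G_bnd_play (T : Type) (A : set (set T)) (As Bs : nat -> set T) :
    Prop :=
  forall n, [/\ A (As n), Bs n `<=` As n & finite_set (Bs n)].

Definition G_bnd_Bob_wins (T : Type) (B : set (set T)) (Bs : nat -> set T) :
    Prop :=
  B (\bigcup_n Bs n) /\ exists k : nat, forall n, Bs n #<= `I_k.

(* A strategy is total on finite sequences of pairs of moves; its values on
   sequences that do not arise in a play following it are irrelevant. *)
Definition Alice_strategy (T : Type) (A : set (set T))
    (sigma : seq (set T * set T) -> set T) : Prop :=
  forall h, A (sigma h).

Definition Alice_has_winning_strategy_G_bnd (T : Type) (A B : set (set T)) :
    Prop :=
  exists2 sigma : seq (set T * set T) -> set T,
    Alice_strategy A sigma &
    forall As Bs : nat -> set T,
      G_bnd_play A As Bs ->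
      (forall n, As n = sigma (history As Bs n)) ->
      ~ G_bnd_Bob_wins B Bs.

Definition open_covers (X : topologicalType) : set (set (set X)) :=
  [set U | (forall V, U V -> open V) /\ cover U id = setT].
Arguments open_covers : clear implicits.

(* Main.v *)
Require Import Defs.
From mathcomp Require Import all_boot.
From mathcomp Require Import boolp classical_sets functions cardinality.
From mathcomp Require Import topology_structure.

(** If Alice has no winning strategy, then in particular playing a prescribed
sequence of covers does not win, and a play that Bob wins against it is the
selection that S_bnd asks for. The other implication goes through spaces that
are compact modulo Rothberger: call a set Y Rothberger if from every sequence of
open covers of Y one can select one member each and still cover Y.

Under S_bnd, every open cover has a finite subfamily whose union M leaves a
Rothberger complement ([S_bnd_Rothberger_mod_finite]). Bob therefore answers
Alice's first cover with that subfamily, whose size does not matter since the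
bound k is his to choose afterwards, and from then on he covers the complement
with at most one set per inning. He can do so because Pawlikowski's theorem
defeats every strategy of Alice in the one-set game on a Rothberger set
([Rothberger_game]).

For the first claim, S_bnd gives a countable subcover, presented as an
increasing union of finite subfamilies with unions M_0, M_1, ... If every
complement of M_j failed to be Rothberger, as witnessed by a sequence of covers
V_j, one glues the V_j together: members of the glued cover A_n lie inside some
M_i, and there refine V_0, ..., V_i on a block of n + 1 indices. A selection of
at most k sets from each A_n splits at n = k. The finitely many sets selected
earlier all lie in a single M_j. Every later set that meets the complement of
M_j sits in some M_i with i > j, hence refines V_j on a block long enough to
distribute the k selected sets over distinct covers of V_j. So the complement
of M_j is covered by one set from each cover of V_j, a contradiction.

For Pawlikowski's theorem, Lindelofness turns Alice's strategy into countable
covers U s 0, U s 1, ... indexed by the nodes s of the tree of finite sequences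
of naturals, and Bob seeks a branch. An argument of Hurewicz on the growth of
functions ([exists_frequent_orbit]) produces an increasing sequence a such that
every y in Y belongs, for infinitely many n, to the open set P_n of the points
that are covered at every node of level n of the finite tree bounded by a, with
index less than a (n + 1). Intersecting one member of each of these covers gives
a cover W_n of P_n alone, but the intersections of members of m + 1 different
W_n do cover Y. Selecting one such intersection for each m, and then using
distinct representatives to attribute the m-th one to a level n of its own,
tells Bob what to play at each node, hence a branch. *)

Set Implicit Arguments.
Unset Strict Implicit.
Unset Printing Implicit Defensive.

Local Open Scope classical_set_scope.
Local Open Scope card_scope.

(** * Finite families *)

Lemma exists_uniform_bound (I : eqType) (l : seq I) (P : I -> nat -> Prop) :
  (forall i, i \in l -> exists n, P i n) ->
  exists N, forall i, i \in l -> exists2 n, n < N & P i n.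
Proof.
elim: l => [_|i l IHl ex_l]; first by exists 0.
have [n Pin] := ex_l i (mem_head i l).
have [j jl|N bound] := IHl; first by apply: ex_l; rewrite inE jl orbT.
exists (maxn n.+1 N) => j; rewrite inE => /predU1P[->|/bound[m ltmN Pjm]].
  by exists n; rewrite // leq_max leqnn.
by exists m; rewrite // leq_max ltmN orbT.
Qed.

Lemma open_forall_in (X : topologicalType) (I : eqType) (l : seq I)
    (U : I -> set X) :
  (forall i, i \in l -> open (U i)) ->
  open [set x | forall i, i \in l -> U i x].
Proof.
elim: l => [_|i l IHl oU].
  have -> : [set x | forall i, i \in [::] -> U i x] = setT by exact/seteqP.
  exact: openT.
have -> : [set x | forall j, j \in i :: l -> U j x] =
    U i `&` [set x | forall j, j \in l -> U j x].
  apply/seteqP; split=> [x Ux|x [Uix Ux] j].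
    by split=> [|j jl]; apply: Ux; rewrite inE ?eqxx ?jl ?orbT.
  by rewrite inE => /predU1P[->|/Ux].
by apply: openI; [|apply: IHl => j jl]; apply: oU; rewrite inE ?eqxx ?jl ?orbT.
Qed.

Lemma exists_common_refinement (X : topologicalType) (I : eqType) (l : seq I)
    (P : I -> set (set X)) (y : X) :
  (forall i, i \in l -> exists V, [/\ P i V, open V & V y]) ->
  exists G, [/\ open G, G y & forall i, i \in l -> exists2 V, P i V & G `<=` V].
Proof.
move=> exV.
have /choice[V VP] i : exists V, i \in l -> [/\ P i V, open V & V y].
  by have [/exV[V]|] := boolP (i \in l); [exists V|exists set0].
exists [set x | forall i, i \in l -> V i x]; split=> [|i /VP[]//|i il].
  by apply: open_forall_in => i /VP[].
by exists (V i) => [|x]; [have [] := VP i il|exact].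
Qed.

(** * Rothberger sets and bounded selections *)

(** The covers consist of open sets of the ambient space, so that Y need not be
viewed as a space. [W n] is only constrained where it contributes to the
covering of Y; this allows passing, and an empty family covering an empty Y. *)
Definition Rothberger (X : topologicalType) (Y : set X) : Prop :=
  forall U : nat -> set (set X), (forall n V, U n V -> open V) ->
  (forall n, Y `<=` cover (U n) id) ->
  exists W : nat -> set X, forall y, Y y -> exists2 n, U n (W n) & W n y.

Lemma card_le_enum (T : Type) (A : set T) (k : nat) : T -> A #<= `I_k ->
  exists e : nat -> T, forall x, A x -> exists2 c, c < k & e c = x.
Proof.
move=> x0 /pcard_leP[f].
have /choice[e eP] c : exists x, forall y, A y -> f y = c -> x = y.
  have [[y [Ay fy]]|no] := pselect (exists y, A y /\ f y = c).
    exists y => z Az fz.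
    by apply: 'inj_f; rewrite ?inE//; apply: etrans fy (esym fz).
  by exists x0 => y Ay fy; case: no; exists y.
exists e => x Ax; exists (f x); first exact: 'funS_f.
exact: eP.
Qed.

(** Compact spaces satisfy the bounded selection principle, by a finite
selection from the first cover alone, and so do Rothberger spaces; by this lemma
all other examples are mixtures of the two. The difficulty is that k becomes
known only after all the covers have been played, so the covers must anticipate
the set M_j in which the selections made before stage k get lost: this is why
[A n] uses more and more of the bad sequences [V l] as its members leave the
sets M_l. *)
Lemma S_bnd_Rothberger_mod_finite (X : topologicalType) (A0 : set (set X)) :
  S_bnd (open_covers X) (open_covers X) -> open_covers X A0 ->
  exists B0, [/\ B0 `<=` A0, finite_set B0 & Rothberger (~` cover B0 id)].
Proof.
move=> HS A0cov.
have [Cs [kC [CsP [_ Cscov]]]] := HS (fun=> A0) (fun=> A0cov).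
pose F j := \bigcup_(n in `I_j) Cs n.
have FA j : F j `<=` A0 by move=> V [n _]; have [+ _ _] := CsP n; apply.
have Ffin j : finite_set (F j).
  by apply: bigcup_finite => // n _; have [] := CsP n.
pose M j := cover (F j) id.
have Mle i j : i <= j -> M i `<=` M j.
  move=> leij x [V [n ni VC] Vx]; exists V => //; exists n => //.
  exact: leq_trans ni leij.
have exM x : exists i, M i x.
  have : cover (\bigcup_n Cs n) id x by rewrite Cscov.
  by move=> [V [n _ VC] Vx]; exists n.+1, V => //; exists n => //=.
apply: contrapT => noB.
have /choice[V VP] j : exists V : nat -> set (set X),
    [/\ forall n O, V n O -> open O, forall n, ~` M j `<=` cover (V n) id &
        forall W : nat -> set X,
          ~ forall y, (~` M j) y -> exists2 n, V n (W n) & W n y].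
  apply: contrapT => noV; apply: noB; exists (F j); split=> // V oV Vcov.
  by apply: contrapT => noW; apply: noV; exists V; split=> // W WP;
     apply: noW; exists W.
(* The pairs (n, c) with c <= n form the n-th block of indices of [V l], so that
   k sets selected from [A n] with n >= k can be sent to distinct indices. On
   [M l] nothing is required of [V l], which covers its complement only. *)
pose A n : set (set X) := [set O | open O /\ exists2 i, O `<=` M i &
  forall l c, l <= i -> c <= n ->
    O `<=` M l \/ exists2 Q, V l (pickle (n, c)) Q & O `<=` Q].
have Acov n : open_covers X (A n).
  split=> [O []//|]; apply/seteqP; split=> // x _.
  have [i Mix] := exM x.
  have oM l : open (M l).
    apply: bigcup_open => Q /FA; have [+ _] := A0cov; exact.
  pose P (t : nat * nat) : set (set X) :=
    [set Q | Q `<=` M t.1 \/ V t.1 (pickle (n, t.2)) Q].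
  have [t _|G [oG Gx GP]] := @exists_common_refinement X (nat * nat)%type
      [seq (l, c) | l <- iota 0 i.+1, c <- iota 0 n.+1] P x.
    have [Mx|nMx] := pselect (M t.1 x).
      by exists (M t.1); split=> //; left.
    have [oV /(_ (pickle (n, t.2)) x nMx)[Q VQ Qx] _] := VP t.1.
    by exists Q; split=> //; [right|apply: oV VQ].
  exists (G `&` M i); last by [].
  split; first exact: openI.
  exists i => [|l c li cn]; first by move=> z [].
  have [|Q [QM|VQ] GQ] := GP (l, c).
  - by apply: allpairs_f; rewrite mem_iota.
  - by left=> z [/GQ/QM].
  - by right; exists Q => // z [/GQ].
have [Bs [k [BsP [_ Bscov]]]] := HS A Acov.
(* The selections before stage k are finitely many, hence lost in one [M j]. *)
have [j Mj] : exists j, forall n O, n < k -> Bs n O -> O `<=` M j.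
  have /finite_seqP[s sE] : finite_set (\bigcup_(n in `I_k) Bs n).
    by apply: bigcup_finite => // n _; have [] := BsP n.
  have [O Os|j jP] := @exists_uniform_bound (set X) s (fun O i => O `<=` M i).
    have [n _ Bn] : (\bigcup_(n in `I_k) Bs n) O by rewrite sE.
    by have [/(_ _ Bn)[_ [i OM _]] _ _] := BsP n; exists i.
  exists j => n O nk BO.
  have : (\bigcup_(n in `I_k) Bs n) O by exists n.
  by rewrite sE => /jP[i ij OM] x /OM; apply: Mle; apply: ltnW.
have /choice[e eP] n : exists e : nat -> set X,
    forall O, Bs n O -> exists2 c, c < k & e c = O.
  by apply: card_le_enum set0 _; have [] := BsP n.
have [_ _ noW] := VP j.
have /choice[W WP] p : exists Q : set X, forall n c, p = pickle (n, c) ->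
    (exists2 Q, V j p Q & e n c `<=` Q) -> V j p Q /\ e n c `<=` Q.
  have [[[n c] ->]|no] := pselect (exists t : nat * nat, p = pickle t);
    last by exists set0 => n c pE; case: no; exists (n, c).
  have [[Q VQ eQ]|noQ] :=
      pselect (exists2 Q, V j (pickle (n, c)) Q & e n c `<=` Q).
    by exists Q => n' c' /(pcan_inj pickleK)[<- <-].
  by exists set0 => n' c' /(pcan_inj pickleK)[<- <-] /noQ.
apply: (noW W) => y nMy.
have : cover (\bigcup_n Bs n) id y by rewrite Bscov.
move=> [O [n _ BO] /= Oy].
have kn : k <= n by rewrite leqNgt; apply/negP => nk; exact/nMy/(Mj n O).
have [c ck ecO] := eP n O BO.
have [/(_ O BO)[_ [i OM OP]] _ _] := BsP n.
have ji : j <= i.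
  by rewrite leqNgt; apply/negP => /ltnW/Mle ij; apply/nMy/ij/OM.
have [OMj|exQ] := OP j c ji (ltnW (leq_trans ck kn)).
  by case: nMy; apply: OMj.
rewrite -ecO in exQ.
have [VQ eQ] := WP _ n c erefl exQ.
by exists (pickle (n, c)) => //; apply: eQ; rewrite ecO.
Qed.

(** * A growth argument of Hurewicz *)

(** Applying the selection to every tail of the sequence of covers gives bounds
[gam N] that succeed at least once beyond N, and [g] eventually dominates them
all. Taking sums makes [g] nondecreasing besides. *)
Lemma exists_frequent_bounds (X : topologicalType) (Y : set X)
    (O : nat -> nat -> set X) :
  Rothberger Y -> (forall n g, open (O n g)) ->
  (forall n y, Y y -> exists g, O n g y) ->
  (forall n g g', g <= g' -> O n g `<=` O n g') ->
  exists g : nat -> nat, {homo g : m n / m <= n} /\ (forall n, n < g n) /\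
    forall y, Y y -> forall N, exists2 n, N <= n & O n (g n) y.
Proof.
move=> YR oO covO leO.
have /choice[gam gamP] N : exists gam : nat -> nat,
    forall y, Y y -> exists2 n, N <= n & O n (gam n) y.
  have [k V [g _ <-]//|k y Yy|W WP] := YR (fun k => range (O (N + k))).
    by have [g Og] := covO (N + k) y Yy; exists (O (N + k) g) => //; exists g.
  have /choice[gam gamP] n : exists g : nat, forall k, n = N + k ->
      range (O (N + k)) (W k) -> O n g = W k.
    have [[k [nE [g _ Og]]]|no] := pselect (exists k, n = N + k /\
        range (O (N + k)) (W k)).
      exists g => k' nE' _; move: (nE'); rewrite nE => /addnI kE.
      by rewrite -kE Og.
    by exists 0 => k nE Wk; case: no; exists k.
  exists gam => y Yy; have [k Wk Wy] := WP y Yy.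
  by exists (N + k); rewrite ?leq_addr// (gamP _ k).
pose g n := (\sum_(N < n.+1) \sum_(i < n.+1) gam N i + n.+1).
exists g; split; last split=> [n|y Yy N].
- move=> m n lemn; apply: leq_add => //.
  rewrite (big_ord_widen n.+1 (fun N => \sum_(i < m.+1) gam N i)) ?ltnS//.
  rewrite big_mkcond /=; apply: leq_sum => N _; case: ifP => // _.
  rewrite (big_ord_widen n.+1 (fun i => gam N i)) ?ltnS//.
  by rewrite big_mkcond /=; apply: leq_sum => i _; case: ifP.
- exact: leq_addl.
have [n Nn On] := gamP N y Yy; exists n => //.
apply: leO On; apply: leq_trans (leq_addr n.+1 _).
rewrite (bigD1 (Ordinal (Nn : N < n.+1)))//=.
by rewrite (bigD1 (ord_max : 'I_n.+1))//= -addnA leq_addr.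
Qed.

Lemma leq_homo_ltn (a : nat -> nat) :
  {homo a : m n / m < n} -> forall n, n <= a n.
Proof.
move=> ainc; elim=> // n IHn; exact: leq_ltn_trans IHn (ainc _ _ (ltnSn n)).
Qed.

(** For y in Y let F m be the least g with y in D m g, a nondecreasing function;
the aim is a sequence a with F (a j) <= a (j + 1) infinitely often. Functions
that are infinitely often above F are available, but the orbit of such a
function may skip all the good arguments. Being infinitely often above F o F
cures this: if g n >= F (F n) with a j <= n < a (j + 1) = g (a j), then either
F n <= a (j + 1) and j is good, or F n > a (j + 1) and
a (j + 2) >= g n >= F (F n) >= F (a (j + 1)), so that j + 1 is good. *)
Lemma exists_frequent_orbit (X : topologicalType) (Y : set X)
    (D : nat -> nat -> set X) :
  Rothberger Y -> (forall m g, open (D m g)) ->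
  (forall m y, Y y -> exists g, D m g y) ->
  (forall m m' g g', m' <= m -> g <= g' -> D m g `<=` D m' g') ->
  exists a : nat -> nat,
  {homo a : m n / m < n} /\
  forall y, Y y -> forall J, exists2 j, J <= j & D (a j) (a j.+1) y.
Proof.
move=> YR oD covD leD.
(* O n g is the set of the points with F (F n) <= g: by monotonicity of F, this
   holds as soon as F n <= q and F q <= g for some q. *)
pose O n g : set X := \bigcup_q (D n q `&` D q g).
have [n g|n y Yy|n g g' leg x [q _ [Dq Dg]]|g [gmono [gext gP]]] :=
    @exists_frequent_bounds X Y O YR.
- by apply: bigcup_open => q _; apply: openI.
- by have [q Dq] := covD n y Yy; have [g Dg] := covD q y Yy; exists g, q.
- by exists q => //; split=> //; apply: leD Dg.
pose a j := iter j g 0; have aS j : a j.+1 = g (a j) by [].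
have ainc : {homo a : m n / m < n}.
  by apply: homo_ltn => [m n p|j]; [exact: ltn_trans|rewrite aS; apply: gext].
have aid := leq_homo_ltn ainc.
exists a; split=> // y Yy J.
have [n Jn [q _ [Dn Dq]]] := gP y Yy (a J).
have [j Jj /andP[ajn naj]] : exists2 j, J <= j & a j <= n < a j.+1.
  have [m mP mmax] := @ex_maxnP (fun j => a j <= n) n (ex_intro _ J Jn)
    (fun j ajn => leq_trans (aid j) ajn).
  exists m; first exact: mmax.
  by rewrite mP ltnNge; apply/negP => /mmax; rewrite ltnn.
have [qa|aq] := leqP q (a j.+1).
  by exists j => //; apply: leD Dn.
exists j.+1; first exact: leqW.
by apply: leD Dq; [exact: ltnW|rewrite aS; apply: gmono; apply: ltnW].
Qed.

(** * Pawlikowski's theorem *)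

(** Greedy choice: before step m only m representatives have been used. *)
Lemma exists_distinct_representatives (T : eqType) (N : nat -> seq T) :
  (forall m, uniq (N m)) -> (forall m, size (N m) = m.+1) ->
  exists2 c : nat -> T, injective c & forall m, c m \in N m.
Proof.
move=> uN sN.
have /choice[pick pickP] (l : seq T) : exists t, t \in N (size l) /\ t \notin l.
  apply: contrapT => no; have : {subset N (size l) <= l}.
    move=> t tN; apply: contrapT => /negP tl; apply: no; by exists t.
  by move=> /(uniq_leq_size (uN _)); rewrite sN ltnn.
pose l m := iter m (fun l => rcons l (pick l)) [::].
have lS m : l m.+1 = rcons (l m) (pick (l m)) by [].
have szl m : size (l m) = m by elim: m => // m IHm; rewrite lS size_rcons IHm.
have ll i j : i < j -> pick (l i) \in l j.
  elim: j => // j IHj; rewrite ltnS leq_eqVlt lS mem_rcons inE.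
  by move=> /predU1P[->|/IHj ->]; rewrite ?eqxx ?orbT.
exists (fun m => pick (l m)) => [i j eij|m]; last first.
  by have [] := pickP (l m); rewrite szl.
wlog ltij : i j eij / i < j.
  by move=> WL; have [/(WL _ _ eij)|/(WL _ _ (esym eij))|] := ltngtP i j.
by have [_] := pickP (l j); rewrite -eij ll.
Qed.

(** The finite subtree of the sequences of length at most m with entries less
than m, as a list. *)
Definition nodes (m : nat) : seq (seq nat) :=
  iter m (fun l => [::] :: [seq i :: w | i <- iota 0 m, w <- l]) [:: [::]].

Lemma mem_nodes m w :
  (w \in nodes m) = (size w <= m) && all (fun i => i < m) w.
Proof.
rewrite /nodes; move: {1 3}m => k; elim: k w => [|k IHk] [|i w] //=.
rewrite in_cons /=; apply/allpairsP/idP => [[[j v] /= []]|].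
  by rewrite mem_iota IHk => /= ltjm + [-> ->]; rewrite ltjm.
rewrite ltnS => /and3P[szw im aw]; exists (i, w).
by rewrite /= mem_iota IHk szw im aw.
Qed.

(** Pawlikowski's theorem for countable covers. The node s stands for the
indices that Bob has played so far, [U s i] for the set he gets by playing i. *)
Lemma Rothberger_tree_branch (X : topologicalType) (Y : set X)
    (U : seq nat -> nat -> set X) :
  Rothberger Y -> (forall s i, open (U s i)) ->
  (forall s y, Y y -> exists i, U s i y) ->
  exists f : nat -> nat, forall y, Y y -> exists n, U (mkseq f n) (f n) y.
Proof.
move=> YR oU covU.
pose D m g : set X :=
  [set x | forall s, s \in nodes m -> exists2 i, i < g & U s i x].
have [m g|m y Yy|m m' g g' lem leg x Dx s|a [ainc aP]] :=
    @exists_frequent_orbit X Y D YR.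
- apply: open_forall_in => s _.
  by apply: (@bigcup_open _ _ `I_g (U s)).
- apply: (exists_uniform_bound (P := fun s i => U s i y)) => s _.
  exact: covU.
- rewrite mem_nodes => /andP[szs als].
  have /Dx[i ig Ux] : s \in nodes m.
    rewrite mem_nodes (leq_trans szs lem); apply: sub_all als => i.
    by move=> /leq_trans; apply.
  by exists i => //; apply: leq_trans ig leg.
have aid := leq_homo_ltn ainc.
(* The nodes of level n that the branch can visit if its entries satisfy
   f i < a i.+1: as a increases, those entries are less than a n for i < n. *)
pose ok n s := (s \in nodes (a n)) && (size s == n).
(* Each point is controlled at infinitely many levels but perhaps not at every
   level, so a cover has to leave the levels free. Asking for m + 1 of them
   leaves one that the choices for smaller m have not taken. *)
pose V m : set (set X) := [set G | open G /\ exists N : seq nat,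
  [/\ uniq N, size N = m.+1 & forall n s, n \in N -> ok n s ->
      exists2 i, i < a n.+1 & G `<=` U s i]].
have [m G []//|m y Yy|G GP] := YR V.
  have [N [uN szN NP]] : exists N : seq nat,
      [/\ uniq N, size N = m.+1 & forall n, n \in N -> D (a n) (a n.+1) y].
    elim: m.+1 => [|k [N [uN szN NP]]]; first by exists [::].
    (* The sum exceeds every element of N, so n is a new level. *)
    have [n nN Dn] := aP y Yy (\sum_(i <- N) i.+1).
    exists (n :: N); split=> [|/=|i]; last 2 [by rewrite szN] .
      rewrite /= uN andbT; apply/negP => inN; move: nN.
      by rewrite (big_rem n)//= ltnNge leq_addr.
    by rewrite inE => /predU1P[->|/NP].
  pose P (t : nat * seq nat) : set (set X) :=
    [set Q | exists2 i, i < a t.1.+1 & Q = U t.2 i].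
  have [[n s] /allpairsPdep[n' [s' [n'N s'n [-> ->]]]]|G [oG Gy GP]] :=
    @exists_common_refinement X _ [seq (n, s) | n <- N, s <- nodes (a n)] P y.
    have [i ia Uy] := NP _ n'N _ s'n.
    by exists (U s' i); split=> //; exists i.
  exists G => //; split=> //; exists N; split=> // n s nN /andP[sn _].
  have [|_ [i ia ->] GU] := GP (n, s); last by exists i.
  exact: allpairs_f_dep.
have /choice[N NP] m : exists N : seq nat, [/\ uniq N, size N = m.+1 &
    V m (G m) -> forall n s, n \in N -> ok n s ->
      exists2 i, i < a n.+1 & G m `<=` U s i].
  have [[_ [N [uN szN NP]]]|no] := pselect (V m (G m)); first by exists N.
  by exists (iota 0 m.+1); rewrite iota_uniq size_iota.
have [|m|c cinj cN] := @exists_distinct_representatives _ N.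
- by move=> m; have [] := NP m.
- by have [] := NP m.
(* At level c m the branch works for the m-th selected set, whichever node of
   that level it has reached. At the other levels any bounded move will do. *)
have /choice[F FP] s : exists i, i < a (size s).+1 /\ forall m,
    c m = size s -> V m (G m) -> ok (size s) s -> G m `<=` U s i.
  have [[m [cm Vm oks]]|no] :=
      pselect (exists m, [/\ c m = size s, V m (G m) & ok (size s) s]).
    have [_ _ /(_ Vm _ s (cN m))] := NP m; rewrite cm => /(_ oks)[i ia GU].
    exists i; split=> // m' cm' _ _.
    by have -> : m' = m by apply: cinj; rewrite cm'.
  exists 0; split=> [|m cm Vm oks]; last by case: no; exists m.
  exact: leq_ltn_trans (ainc _ _ (ltnSn _)).
pose b n := iter n (fun s => rcons s (F s)) [::].
pose f n := F (b n).
have bE n : b n = mkseq f n.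
  by elim: n => // n IHn; rewrite mkseqS -IHn.
have szb n : size (b n) = n by rewrite bE size_mkseq.
exists f => y Yy; have [m Vm Gy] := GP y Yy.
exists (c m); have [_ /(_ m)] := FP (b (c m)).
rewrite szb /f -bE; apply => //.
rewrite /ok szb eqxx andbT mem_nodes szb aid bE /=.
apply/allP => _ /mapP[i + ->]; rewrite mem_iota /= => ic.
have [+ _] := FP (b i); rewrite szb => /leq_trans; apply.
by move: ic; rewrite leq_eqVlt => /predU1P[->|/ainc/ltnW].
Qed.

(** Pawlikowski's theorem. [tau ws] is the cover that Alice plays after Bob's
moves [ws]. Enumerating countable subcovers reduces it to a tree of naturals. *)
Lemma Rothberger_game (X : topologicalType) (Y : set X)
    (tau : seq (set X) -> set (set X)) :
  Rothberger Y -> (forall ws, open_covers X (tau ws)) ->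
  exists W : nat -> set X,
    forall y, Y y -> exists2 n, tau (mkseq W n) (W n) & W n y.
Proof.
move=> YR tauP.
have /choice[e eP] ws : exists e : nat -> set X,
    forall y, Y y -> exists2 i, tau ws (e i) & e i y.
  have [otau covtau] := tauP ws.
  by apply: (YR (fun=> tau ws)) => // _; rewrite covtau.
pose dec s : seq (set X) := foldl (fun ws i => rcons ws (e ws i)) [::] s.
(* The enumeration [e ws] may leave [tau ws]; such indices count as empty. *)
pose U s i : set X := [set x | tau (dec s) (e (dec s) i) /\ e (dec s) i x].
have [s i|s y Yy|f fP] := @Rothberger_tree_branch X Y U YR.
- have [tauei|ntau] := pselect (tau (dec s) (e (dec s) i)).
    have -> : U s i = e (dec s) i by apply/seteqP; split=> [x []|x].
    by have [+ _] := tauP (dec s); apply.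
  have -> : U s i = set0 by apply/seteqP; split=> [x []|].
  exact: open0.
- by have [i taui eiy] := eP (dec s) y Yy; exists i.
pose W n := e (dec (mkseq f n)) (f n).
have decE n : dec (mkseq f n) = mkseq W n.
  elim: n => // n IHn; rewrite !mkseqS /dec foldl_rcons -/(dec _) IHn.
  by rewrite /W IHn.
exists W => y Yy; have [n [taun en]] := fP y Yy.
by exists n; rewrite // -decE.
Qed.

(** * The bounded game *)

Lemma S_bnd_Alice_has_no_winning_strategy (X : topologicalType) :
  S_bnd (open_covers X) (open_covers X) ->
  ~ Alice_has_winning_strategy_G_bnd (open_covers X) (open_covers X).
Proof.
move=> HS [sigma sigmaP win].
have [B0 [B0A B0fin B0R]] :=
  S_bnd_Rothberger_mod_finite HS (sigmaP [::]).
(* Bob's answer to the n-th cover after the first is the singleton of [W n], or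
   the empty family if [W n] is not a member of that cover. *)
pose hist ws := foldl (fun h w => rcons h (sigma h, [set w] `&` sigma h))
  [:: (sigma [::], B0)] ws.
have [W WP] := Rothberger_game B0R (fun ws => sigmaP (hist ws)).
pose As n := if n is m.+1 then sigma (hist (mkseq W m)) else sigma [::].
pose Bs n := if n is m.+1 then [set W m] `&` As m.+1 else B0.
have histE n : history As Bs n.+1 = hist (mkseq W n).
  elim: n => // n IHn.
  rewrite /history mkseqS -/(history As Bs n.+1) IHn.
  by rewrite /hist mkseqS foldl_rcons.
have play : G_bnd_play (open_covers X) As Bs.
  case=> [|n]; first by split=> //; apply: sigmaP.
  split; [exact: sigmaP|exact: subIsetr|].
  exact/finite_setIl/finite_set1.
apply: (win As Bs play) => [[|n]//|]; first by rewrite histE.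
split; first split=> [V [n _ BV]|].
- have [[+ _] BA _] := play n; apply; exact: BA.
- apply/seteqP; split=> // x _.
  have [[V B0V Vx]|nx] := pselect (cover B0 id x).
    by exists V => //; exists 0.
  by have [n An Wx] := WP x nx; exists (W n) => //; exists n.+1.
have /finite_set_leP[k B0k] := B0fin.
exists k.+1 => -[|n].
  by apply: card_le_trans B0k _; rewrite card_le_II.
apply: (@card_le_trans _ _ _ `I_1); last by rewrite card_le_II.
apply: card_le_trans (subset_card_le (@subIsetl _ _ _)) _.
by have := @card_set1 _ (W n); rewrite card_eq_le => /andP[].
Qed.

Theorem theorem5p3 (X : topologicalType) :
  S_bnd (open_covers X) (open_covers X) <->
  ~ Alice_has_winning_strategy_G_bnd (open_covers X) (open_covers X).
Proof.
split; first exact: S_bnd_Alice_has_no_winning_strategy.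
move=> nwin As AsP; apply: contrapT => nB; apply: nwin.
exists (fun h => As (size h)) => [h|As' Bs play AsE [Bcov [k Bk]]].
  exact: AsP.
apply: nB; exists Bs, k; split=> // n.
have [_ + Bfin] := play n.
by rewrite AsE size_mkseq => BA; split.
Qed.
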